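(* Let $\mathbf{d}=(d_1,\ldots,d_N)$ and $\mathbf{r}=(r_0=1,r_1,\ldots,r_{N-1},r_N=1)$ be sequences of positive integers. Let $\psi=(\psi_{j_1\cdots j_N})$ be a $d_1\times\cdots\times d_N$ tensor of indeterminates and let $\psi^{(i)}$ be its flattening corresponding to the partition $\{1,\ldots,i\}\mid\{i+1,\ldots,N\}$. Then the homogeneous prime ideal of the tensor train variety $\mathrm{TT}_{\mathbf{d},\mathbf{r}}$ in $\mathbb{C}[\psi]$ is $$\mathcal{I}(\mathrm{TT}_{\mathbf{d},\mathbf{r}})=\sum_{i=1}^{N-1}\big\langle (r_i+1)\text{-minors of }\psi^{(i)}\big\rangle .$$
   Context: The tensor train variety $\mathrm{TT}_{\mathbf{d},\mathbf{r}}\subseteq\mathbb{P}\big(\bigotimes_{i=1}^N\mathbb{C}^{d_i}\big)$ is the Zariski closure of the set of classes $[\psi]$ of nonzero tensors of the form $$\psi_{j_1\cdots j_N}=\sum_{\alpha_1=1}^{r_1}\cdots\sum_{\alpha_{N-1}=1}^{r_{N-1}}A^1_{j_1,\alpha_1}A^2_{j_2,\alpha_2,\alpha_1}\cdots A^{N-1}_{j_{N-1},\alpha_{N-1},\alpha_{N-2}}A^N_{j_N,\alpha_{N-1}},$$ where $A^i\in\mathbb{C}^{d_i}\otimes\mathbb{C}^{r_i}\otimes(\mathbb{C}^{r_{i-1}})^*$ are arbitrary (the one-dimensional factors for $r_0=r_N=1$ are omitted). The flattening $\psi^{(i)}$ is the $(d_1\cdots d_i)\times(d_{i+1}\cdots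 d_N)$ matrix whose entry in row $(j_1,\ldots,j_i)$ and column $(j_{i+1},\ldots,j_N)$ is $\psi_{j_1\cdots j_N}$. $\mathbb{C}[\psi]$ is the polynomial ring in the entries of $\psi$ and $\mathcal{I}(X)$ is the ideal generated by all homogeneous polynomials vanishing on $X$. *)

(* Defs.v *)
From HB Require Import structures.
From mathcomp Require Import all_boot all_order all_algebra.
From mathcomp Require Import mpoly complex.
From mathcomp Require Import boolp classical_sets reals.

Set Implicit Arguments.
Unset Strict Implicit.
Unset Printing Implicit Defensive.

Import GRing.Theory.
Local Open Scope classical_set_scope.
Local Open Scope ring_scope.

Section Ideals.
Variable A : comNzRingType.
Implicit Types (S J : set A).

Definition ideal_gen S : set A :=
  [set p | exists (n : nat) (a g : 'I_n -> A),
     (forall k, S (g k)) /\ p = \sum_(k < n) a k * g k].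

Definition ideal_sum (I : finType) (P : pred I) (J : I -> set A) : set A :=
  [set p | exists q : I -> A,
     (forall i, P i -> J i (q i)) /\ p = \sum_(i | P i) q i].

(* [idealr_closed] contains the condition [1 \notin J]. *)
Definition prime_ideal J : Prop :=
  idealr_closed [pred p in J] /\ prime_idealr_closed [pred p in J].

End Ideals.

Section Projective.
Variables (K : fieldType) (T : finType).

Definition coord_space := {ffun T -> K^o}.

(* Points are the lines through the origin. *)
Definition proj_space := {L : {vspace coord_space} | \dim L == 1%N}.

(* The variable attached to [t : T] is ['X_(enum_rank t)]. *)
Definition coord_ring := {mpoly K[#|T|]}.

Definition eval_at (f : coord_ring) (x : coord_space) : K :=
  f.@[fun k => x (enum_val k)].

Definition homogeneous (f : coord_ring) : Prop :=
  exists k : nat, f \is k.-homog.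

(* Only meant for homogeneous [f], for which it can be tested on any nonzero
   vector of the line. *)
Definition vanishes_at (f : coord_ring) (L : proj_space) : Prop :=
  forall x : coord_space, x \in val L -> eval_at f x = 0.

Definition zero_locus (S : set coord_ring) : set proj_space :=
  [set L | forall f, S f -> vanishes_at f L].

Definition zariski_closed (Z : set proj_space) : Prop :=
  exists2 S : set coord_ring, S `<=` homogeneous & Z = zero_locus S.

Definition zariski_closure (X : set proj_space) : set proj_space :=
  smallest zariski_closed X.

Definition vanishing_ideal (X : set proj_space) : set coord_ring :=
  ideal_gen [set f | homogeneous f /\ forall L, X L -> vanishes_at f L].

Definition homogeneous_ideal (J : set coord_ring) : Prop :=
  forall f, J f -> forall k : nat, J (pihomog mdeg k f).

End Projective.

(* Tensor factors are numbered from 0: [k : 'I_N] stands for the factor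
    [k + 1], so that [d k] is $d_{k+1}$. The bond dimensions keep their
    numbering, [r i] being $r_i$ for $0 \le i \le N$. *)

Section TensorTrain.
Variables (K : fieldType) (N : nat) (d : 'I_N -> nat).

Definition tensor_idx := {dffun forall k : 'I_N, 'I_(d k)}.

Definition tensor := coord_space K tensor_idx.

Definition left_bond (k : 'I_N) : 'I_N.+1 := widen_ord (leqnSn N) k.
Definition right_bond (k : 'I_N) : 'I_N.+1 := lift ord0 k.

(* [A k j a b] is $A^{k+1}_{j,a,b}$, with [a] the index of the right bond and
   [b] that of the left bond. *)
Definition tt_cores (r : 'I_N.+1 -> nat) :=
  forall k : 'I_N, 'I_(d k) -> 'M[K]_(r (right_bond k), r (left_bond k)).

(* The sum also runs over the indices $\alpha_0$ and $\alpha_N$, which take a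
   single value when $r_0 = r_N = 1$. *)
Definition tt_contract (r : 'I_N.+1 -> nat) (A : tt_cores r) : tensor :=
  [ffun j : tensor_idx =>
     \sum_(al : {dffun forall i : 'I_N.+1, 'I_(r i)})
       \prod_(k < N) A k (j k) (al (right_bond k)) (al (left_bond k))].

Definition tt_variety (r : 'I_N.+1 -> nat) : set (proj_space K tensor_idx) :=
  zariski_closure
    [set L | exists A : tt_cores r,
       tt_contract A != 0 /\ val L = <[tt_contract A]>%VS].

Definition row_idx (i : nat) :=
  {dffun forall k : {k : 'I_N | (k < i)%N}, 'I_(d (val k))}.
Definition col_idx (i : nat) :=
  {dffun forall k : {k : 'I_N | (i <= k)%N}, 'I_(d (val k))}.

Definition merge_idx (i : nat) (u : row_idx i) (v : col_idx i) : tensor_idx :=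
  [ffun k : 'I_N =>
     match ltnP k i with
     | LtnNotGeq lt_ki => u (exist _ k lt_ki)
     | GeqNotLtn le_ik => v (exist _ k le_ik)
     end].

Definition flattening (i : nat) :
    'M[coord_ring K tensor_idx]_(#|{: row_idx i}|, #|{: col_idx i}|) :=
  \matrix_(u, v) 'X_(enum_rank (merge_idx (enum_val u) (enum_val v))).

End TensorTrain.

Definition minors (A : comNzRingType) (m n s : nat) (M : 'M[A]_(m, n)) : set A :=
  [set p | exists (f : 'I_s -> 'I_m) (g : 'I_s -> 'I_n),
     [/\ {homo f : a b / (a < b)%N}, {homo g : a b / (a < b)%N}
       & p = \det (mxsub f g M)]].

(* Main.v *)
Require Import Defs.
From HB Require Import structures.
From mathcomp Require Import all_boot all_order all_algebra all_fingroup.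
From mathcomp Require Import mpoly complex.
From mathcomp Require Import boolp classical_sets reals.

(* The vanishing ideal consists of the polynomials that vanish at all tensors
   contracted from cores; it is homogeneous because cores can be rescaled, and
   prime because two systems of cores are joined by a line. Flattenings of
   contracted tensors factor through the bond, so the minors vanish on them.

   Conversely, write a form of degree n as a sum over words w of n tensor
   indices, and let N-tuples of permutations of the n positions act on words,
   one permutation for each tensor factor. Modulo the minors of the i-th
   flattening, the relative permutation of the factors i and i + 1 can be
   antisymmetrized over r_i + 1 positions to zero, hence it matters only through
   its action on words of length n in r_i letters: the kernel of that action of
   the group algebra of S_n is spanned by such antisymmetrizers. Vanishing on
   contracted tensors says precisely that the coefficients of the form, summed
   over the N-tuples of permutations, are orthogonal to all matrix coefficients
   of these actions, so the form, averaged over the N-tuples, is 0 modulo the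
   minors. *)

Set Implicit Arguments.
Unset Strict Implicit.
Unset Printing Implicit Defensive.

Import GRing.Theory Num.Theory.
Local Open Scope classical_set_scope.
Local Open Scope ring_scope.

(** * Antisymmetrizers and the lexicographic order on permutations *)

Section PermExtension.
Variables (k n : nat) (e : 'I_k -> 'I_n) (e_inj : injective e).

Definition perm_ext_fun (s : 'S_k) (m : 'I_n) : 'I_n :=
  if [pick a | e a == m] is Some a then e (s a) else m.

Lemma perm_ext_fun_inj s : injective (perm_ext_fun s).
Proof.
move=> m m'; rewrite /perm_ext_fun.
case: pickP => [a /eqP<-|em]; case: pickP => [b /eqP<-|em'] //.
- by move=> /e_inj/perm_inj->.
- by move=> E; have := em' (s a); rewrite E eqxx.
- by move=> E; have := em (s b); rewrite -E eqxx.
Qed.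

Definition perm_ext (s : 'S_k) : 'S_n := perm (@perm_ext_fun_inj s).

Lemma perm_ext_in s a : perm_ext s (e a) = e (s a).
Proof.
rewrite permE /perm_ext_fun; case: pickP => [b /eqP/e_inj->//|/(_ a)].
by rewrite eqxx.
Qed.

Lemma perm_ext_out s m : (forall a, e a != m) -> perm_ext s m = m.
Proof.
move=> em; rewrite permE /perm_ext_fun; case: pickP => // a.
by rewrite (negPf (em a)).
Qed.

Lemma perm_ext1 : perm_ext 1%g = 1%g.
Proof.
apply/permP => m; rewrite permE perm1 /perm_ext_fun.
by case: pickP => // a /eqP<-; rewrite perm1.
Qed.

End PermExtension.

Section LexRank.
Variable n : nat.
Implicit Types s t u : 'S_n.

Definition perm_lt s t : Prop :=
  exists2 m : 'I_n, forall m' : 'I_n, (m' < m)%N -> s m' = t m'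
                  & (s m < t m)%N.

Definition perm_key s : n.-tuplelexi 'I_n := [tuple s m | m < n].

(** An integer measure of the lexicographic order, which turns the descent on permutations into
    induction on a bound. *)
Definition perm_rank t := #|[pred u : 'S_n | (perm_key u < perm_key t)%O]|.

Lemma perm_key_inj : injective perm_key.
Proof.
move=> s t E; apply/permP => m.
by move: (congr1 (fun x => tnth x m) E); rewrite !tnth_mktuple.
Qed.

Lemma perm_key_lt s t : perm_lt s t -> (perm_key s < perm_key t)%O.
Proof.
move=> [m eq_st lt_st]; apply/Order.TupleLexiOrder.ltxi_tuplePlt; exists m.
  by move=> m' lt_m'; rewrite !tnth_mktuple eq_st.
by rewrite !tnth_mktuple ltEord.
Qed.

Lemma perm_rank_key_lt s t :
  (perm_key s < perm_key t)%O -> (perm_rank s < perm_rank t)%N.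
Proof.
move=> lt_st; apply: proper_card; apply/properP; split.
  apply/fintype.subsetP => u.
  by rewrite !inE => /Order.POrderTheory.lt_trans; apply.
by exists s; rewrite !inE // Order.POrderTheory.ltxx.
Qed.

Lemma perm_rank_lt s t : perm_lt s t -> (perm_rank s < perm_rank t)%N.
Proof. by move=> /perm_key_lt/perm_rank_key_lt. Qed.

Lemma perm_rank_inj : injective perm_rank.
Proof.
move=> s t E; apply: perm_key_inj.
case: (Order.TotalTheory.ltgtP (perm_key s) (perm_key t)) => //.
  by move=> /perm_rank_key_lt; rewrite E ltnn.
by move=> /perm_rank_key_lt; rewrite E ltnn.
Qed.

End LexRank.

Section ChainHeight.
Variables (n : nat) (s : 'S_n).

Definition dec_step : rel 'I_n := [rel a b : 'I_n | (a < b)%N && (s b < s a)%N].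

Lemma dec_step_trans : transitive dec_step.
Proof.
move=> b a c /andP[ab sba] /andP[bc scb]; apply/andP; split.
  exact: ltn_trans bc.
exact: ltn_trans sba.
Qed.

(** Number of positions before [m] in a longest decreasing chain ending at [m]. For positive [r] the
    range [l < r] makes it an allowed letter, and it cuts nothing off when no chain has [r + 1]
    positions. *)
Definition chain_height r (m : 'I_n) : nat :=
  \max_(l < r | [exists c : l.-tuple 'I_n, sorted dec_step (rcons c m)]) l.

Lemma chain_height_lt r m : (0 < r)%N -> (chain_height r m < r)%N.
Proof.
by case: r => // r _; apply/bigmax_leqP => -[l lr] _ /=; rewrite -ltnS.
Qed.

(** A longest chain ending at [m] can be prolonged by [m']; as no chain has [r + 1] positions, the
    prolonged one stays within the range [l < r]. *)
Lemma chain_height_mono r m m' : (0 < r)%N ->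
  (forall c : r.+1.-tuple 'I_n, ~~ sorted dec_step c) ->
  dec_step m m' -> (chain_height r m < chain_height r m')%N.
Proof.
move=> r_gt0 nochain mm'.
pose P (l : 'I_r) := [exists c : l.-tuple 'I_n, sorted dec_step (rcons c m)].
have P0 : (0 < #|P|)%N.
  apply/card_gt0P; exists (Ordinal r_gt0); rewrite unfold_in.
  by apply/existsP; exists [tuple].
have [l /existsP[c sc] hE] := @eq_bigmax_cond _ P (fun i => nat_of_ord i) P0.
rewrite /chain_height hE.
have scm : sorted dec_step (rcons (rcons c m) m').
  case: {hE} c sc => /= -[|x c] _ /=; first by rewrite mm'.
  by rewrite !rcons_path last_rcons => /andP[-> ->].
have lr : (l.+1 < r)%N.
  rewrite ltn_neqAle ltn_ord andbT; apply/eqP => lr.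
  have sz : size (rcons (rcons c m) m') == r.+1.
    by rewrite !size_rcons size_tuple lr.
  by have := nochain (Tuple sz); rewrite /= scm.
apply: leq_trans (leq_bigmax_cond (Ordinal lr) _); first by [].
by apply/existsP; exists [tuple of rcons c m].
Qed.

End ChainHeight.

(* [rho] is [rho'] composed with [t]; the alphabet ['I_R] is common to all bonds,
   and [r] cuts out the letters that are allowed. *)
Definition word_match n R r (rho rho' : {ffun 'I_n -> 'I_R}) (t : 'S_n) :=
  [forall m, (rho' m < r)%N] && [forall m, rho m == rho' (t m)].

Section AlternatingMaps.
Variables (K : numFieldType) (n r R : nat).
Hypotheses (r_gt0 : (0 < r)%N) (r_leR : (r <= R)%N).
Implicit Types rho : {ffun 'I_n -> 'I_R}.

(** Pigeonhole: [rho'] has the same letter at two of the [r + 1] positions [t (e a)]. The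
    corresponding transposition reverses every sign and keeps the match, so the sum equals its
    opposite. *)
Lemma antisym_word_match (e : 'I_r.+1 -> 'I_n) (e_inj : injective e) t rho rho' :
  \sum_(x : 'S_r.+1) (-1) ^+ x * (word_match r rho rho' (perm_ext e_inj x * t))%:R
    = 0 :> K.
Proof.
have [small|/negPf nsmall] := boolP [forall m, (rho' m < r)%N]; last first.
  by rewrite big1 // => x _; rewrite /word_match nsmall mulr0.
have /injectivePn[a [b ab gab]] :
    ~~ injectiveb (fun a => Ordinal (forallP small (t (e a)))).
  apply/negP => /injectiveP/leq_card; rewrite !card_ord; by rewrite ltnn.
set S := LHS; suff /eqP : - S = S by rewrite eqNr => /eqP.
rewrite {2}/S (reindex_inj (mulIg (tperm a b))) /= -sumrN.
apply: eq_bigr => x _.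
rewrite odd_permM odd_tperm ab addbT signrN mulNr; congr (- (_ * _%:R)).
rewrite /word_match small /=; congr nat_of_bool; apply: eq_forallb => m.
rewrite !permM.
have [[c ->]|em] : (exists c, m = e c) \/ forall c, e c != m.
- have [/existsP[c /eqP<-]|/existsPn] := boolP [exists c, e c == m].
    by left; exists c.
  by right.
- rewrite !perm_ext_in permM; congr (_ == _).
  by case: tpermP => // ->; apply: val_inj; [have /(congr1 val) := gab
    | have /(congr1 val)/esym := gab].
- by rewrite !perm_ext_out.
Qed.

Variables (A : lmodType K) (I : A -> Prop) (Phi : 'S_n -> A).
Hypotheses (I0 : I 0) (ID : forall x y, I x -> I y -> I (x + y)).
Hypothesis IZ : forall c x, I x -> I (c *: x).
Hypothesis Phi_alt : forall (e : 'I_r.+1 -> 'I_n) (e_inj : injective e) t,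
  I (\sum_(x : 'S_r.+1) (-1) ^+ x *: Phi (perm_ext e_inj x * t)%g).

(* Descent on the lexicographically largest permutation [s] in the support of
   [v]. If [s] has a decreasing chain of length [r + 1], antisymmetrizing along
   it replaces [s] by smaller permutations. Otherwise labelling each position by
   its chain height and each value by the label of its position gives a pair of
   words matched by [s] and, besides, only by larger permutations, so that
   [v s = 0]. *)
Lemma alternating_kernel (v : 'S_n -> K) :
  (forall rho rho', \sum_t v t * (word_match r rho rho' t)%:R = 0) ->
  I (\sum_t v t *: Phi t).
Proof.
have [b] : exists b, forall t, v t != 0 -> (perm_rank t < b)%N.
  by exists #|'S_n|.+1 => t _; rewrite ltnS; exact: max_card.
elim: b v => [|b IHb] v suppv kerv.
  rewrite big1 // => t _; case: (eqVneq (v t) 0) => [->|/suppv //].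
  by rewrite scale0r.
have [s /eqP rk_s|no_s] := pickP (fun s : 'S_n => perm_rank s == b); last first.
  apply: IHb => // t /suppv; rewrite ltnS leq_eqVlt no_s.
  by [].
have supp_lt t : t != s -> v t != 0 -> (perm_rank t < b)%N.
  move=> ts /suppv; rewrite ltnS leq_eqVlt => /orP[|//].
  by rewrite -rk_s => /eqP/perm_rank_inj ets; rewrite ets eqxx in ts.
have [/existsP[c sc]|/existsPn nochain] :=
    boolP [exists c : r.+1.-tuple 'I_n, sorted (dec_step s) c]; last first.
  have hR m : (chain_height s r m < R)%N.
    by apply: leq_trans r_leR; apply: chain_height_lt.
  pose rho := [ffun m => Ordinal (hR m)]; pose rho' := [ffun y => rho ((s^-1)%g y)].
  have small : [forall m, (rho' m < r)%N].
    by apply/forallP => m; rewrite !ffunE; apply: chain_height_lt.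
  have vs0 : v s = 0.
    have := kerv rho rho'; rewrite (bigD1 s) //= big1 => [|t ts].
      rewrite /word_match small /= addr0.
      have -> : [forall m, rho m == rho' (s m)].
        by apply/forallP => m; rewrite [rho' _]ffunE permK.
      by rewrite mulr1.
    have [/andP[_ /forallP mt]|] := boolP (word_match r rho rho' t); last first.
      by rewrite mulr0.
    suff /perm_rank_lt : perm_lt s t.
      rewrite rk_s => bt; case: (eqVneq (v t) 0) => [->|/(supp_lt _ ts)].
        by rewrite mul0r.
      by rewrite ltnNge ltnW.
    (* Let [m] be the first place where [s] and [t] differ, and [m'] the place where [s] takes the
       value [t m]. Then [m < m'] and both have the same height, so [s m' < s m] would contradict
       strict growth of heights. *)
    have [m0 m0P] : exists m, s m != t m.
      apply/existsP; rewrite -negb_forall; apply: contraNN ts.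
      by move=> /forallP st; apply/eqP/permP => m; rewrite (eqP (st m)).
    case: (@arg_minnP _ m0 (fun m => s m != t m) val m0P) => m mP mmin.
    have below (m' : 'I_n) : (m' < m)%N -> s m' = t m'.
      by move=> lt; apply/eqP; apply: contraTT lt => /mmin; rewrite -leqNgt.
    exists m => //; pose m' := (s^-1)%g (t m).
    have sm' : s m' = t m by rewrite permKV.
    have hm : chain_height s r m' = chain_height s r m.
      by have := mt m; rewrite !ffunE => /eqP/(congr1 val) /= ->.
    have lt_mm' : (m < m')%N.
      rewrite ltn_neqAle leqNgt; apply/andP; split.
        by apply: contraNN mP => /eqP/val_inj E; rewrite [X in s X]E sm'.
      apply/negP => lt; have := below _ lt; rewrite sm' => /perm_inj E.
      by rewrite E ltnn in lt.
    rewrite -sm' ltn_neqAle leqNgt; apply/andP; split.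
      apply/eqP => /val_inj/perm_inj E; by rewrite -E ltnn in lt_mm'.
    apply/negP => lt.
    have := @chain_height_mono _ s r m m' r_gt0 nochain.
    by rewrite /dec_step /= lt_mm' lt hm ltnn => /(_ isT).
  apply: IHb => // t vt; apply: supp_lt => //.
  by apply: contraNneq vt => ->; rewrite vs0.
pose e := tnth c.
have e_mono (a a' : 'I_r.+1) : (a < a')%N -> dec_step s (e a) (e a').
  move=> lt; rewrite /e !(tnth_nth (e ord0)).
  by apply: (sorted_ltn_nth (@dec_step_trans n s)) => //;
    rewrite ?inE ?size_tuple ?ltn_ord.
have e_inj : injective e.
  move=> a a' E; apply: val_inj; case: (ltngtP a a') => // /e_mono;
  by rewrite /dec_step /= E ltnn.
(* The first chain index moved by [x] goes to a later one, where [s] is smaller; all earlier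
   positions keep their value. *)
have ext_lt x : x != 1%g -> perm_lt (perm_ext e_inj x * s)%g s.
  move=> x1; have [a0 a0P] : exists a, x a != a.
    apply/existsP; rewrite -negb_forall; apply: contraNN x1.
    by move=> /forallP st; apply/eqP/permP => m; rewrite (eqP (st m)) perm1.
  case: (@arg_minnP _ a0 (fun a => x a != a) val a0P) => a aP amin.
  have below (b' : 'I_r.+1) : (b' < a)%N -> x b' = b'.
    by move=> lt; apply/eqP; apply: contraTT lt => /amin; rewrite -leqNgt.
  have lt_a : (a < x a)%N.
    rewrite ltn_neqAle leqNgt eq_sym aP /=.
    apply/negP => lt; have /perm_inj E := below _ lt.
    by rewrite E eqxx in aP.
  have [_ lts] := andP (e_mono _ _ lt_a).
  exists (e a); last by rewrite permM perm_ext_in.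
  move=> m lt; rewrite permM.
  have [/existsP[b' /eqP eb]|/existsPn em] := boolP [exists b', e b' == m].
    rewrite -eb perm_ext_in below //.
    case: (ltngtP b' a) => //.
      by move=> /e_mono/andP[lt' _]; rewrite -eb ltnNge ltnW in lt.
    by move=> /val_inj E; rewrite -eb E ltnn in lt.
  by rewrite perm_ext_out.
have ext_eq x : (perm_ext e_inj x * s == s)%g = (x == 1%g).
  apply/eqP/eqP => [E|->]; last by rewrite perm_ext1 mul1g.
  apply/eqP; apply: contraPT E => /ext_lt/perm_rank_lt lt E.
  by rewrite E ltnn in lt.
(* Coefficients of the antisymmetrizer of [s] along the chain. That of [s] is 1, so subtracting
   [v s] times them clears [s] and brings in only smaller permutations. *)
pose alt t : K := \sum_(x : 'S_r.+1 | (perm_ext e_inj x * s)%g == t) (-1) ^+ x.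
have sum_alt (B : lmodType K) (F : 'S_n -> B) :
    \sum_t alt t *: F t
      = \sum_(x : 'S_r.+1) (-1) ^+ x *: F (perm_ext e_inj x * s)%g.
  rewrite (partition_big (fun x => (perm_ext e_inj x * s)%g) predT) //=.
  apply: eq_bigr => t _; rewrite /alt scaler_suml.
  by apply: eq_bigr => x /eqP->.
have alt_s : alt s = 1.
  rewrite /alt (eq_bigl (xpred1 1%g)) => [|x]; last exact: ext_eq.
  by rewrite big_pred1_eq odd_perm1.
pose v' t := v t - v s * alt t.
have -> : \sum_t v t *: Phi t = \sum_t v' t *: Phi t + v s *: \sum_t alt t *: Phi t.
  rewrite scaler_sumr -big_split; apply: eq_bigr => t _ /=.
  by rewrite scalerA -scalerDl subrK.
apply: ID; last by apply: IZ; rewrite sum_alt.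
apply: IHb => [t|rho rho']; last first.
  under eq_bigr => t _ do rewrite mulrBl -mulrA.
  rewrite sumrB kerv sub0r -mulr_sumr.
  by rewrite (sum_alt K^o) antisym_word_match mulr0 oppr0.
have [->|ts] := eqVneq t s; first by rewrite /v' alt_s mulr1 subrr eqxx.
rewrite /v'; have [->|/(supp_lt _ ts)->//] := eqVneq (v t) 0.
move=> nz; have [x /eqP xt|no_x] :=
  pickP (fun x => (perm_ext e_inj x * s)%g == t); last first.
  by case/eqP: nz; rewrite /alt big_pred0 // mulr0 subr0.
rewrite -rk_s -xt; apply/perm_rank_lt/ext_lt; apply: contraNneq ts => x1.
by rewrite -xt x1 perm_ext1 mul1g.
Qed.

End AlternatingMaps.

(** * Straightening *)

(** For the matrix [B] of word matches, [B *m pinvmx B *m B = B] puts the row of [s] in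
    [1 - B *m pinvmx B] into the left kernel of [B], to which [alternating_kernel] applies. The
    permutation [s] enters the coefficients only through its matches, which is the form that the
    orthogonality relations can cancel. *)
Lemma straightening_coefficients (K : numFieldType) (n r R : nat) :
  (0 < r)%N -> (r <= R)%N ->
  exists q : 'S_n -> {ffun 'I_n -> 'I_R} * {ffun 'I_n -> 'I_R} -> K,
  forall (A : lmodType K) (I : A -> Prop) (Phi : 'S_n -> A),
    I 0 -> (forall x y, I x -> I y -> I (x + y)) ->
    (forall c x, I x -> I (c *: x)) ->
    (forall (e : 'I_r.+1 -> 'I_n) (e_inj : injective e) t,
       I (\sum_(x : 'S_r.+1) (-1) ^+ x *: Phi (perm_ext e_inj x * t)%g)) ->
  forall s, I (Phi s -
    \sum_t (\sum_x (word_match r x.1 x.2 s)%:R * q t x) *: Phi t).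
Proof.
move=> r_gt0 r_leR.
pose W := ({ffun 'I_n -> 'I_R} * {ffun 'I_n -> 'I_R})%type.
pose B : 'M[K]_(#|{: 'S_n}|, #|{: W}|) :=
  \matrix_(i, j) (word_match r (enum_val j).1 (enum_val j).2 (enum_val i))%:R.
have BE t (y : W) :
    B (enum_rank t) (enum_rank y) = (word_match r y.1 y.2 t)%:R.
  by rewrite mxE !enum_rankK.
exists (fun t x => pinvmx B (enum_rank x) (enum_rank t)).
move=> A I Phi I0 ID IZ Phi_alt s.
pose c t : K := \sum_(x : W) (word_match r x.1 x.2 s)%:R
                              * pinvmx B (enum_rank x) (enum_rank t).
have cE t : c t = (B *m pinvmx B) (enum_rank s) (enum_rank t).
  rewrite mxE (reindex (@enum_rank W)) /=; last first.
    by apply: onW_bij; apply: enum_rank_bij.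
  by apply: eq_bigr => x _; rewrite BE.
rewrite -/c.
have -> : Phi s - \sum_t c t *: Phi t = \sum_t ((t == s)%:R - c t) *: Phi t.
  under [RHS]eq_bigr => t _ do rewrite scalerBl.
  rewrite sumrB; congr (_ - _); rewrite (bigD1 s) //= eqxx scale1r big1 ?addr0 //.
  by move=> t /negPf->; rewrite scale0r.
apply: (alternating_kernel r_gt0 r_leR) => // rho rho'.
under eq_bigr => t _ do rewrite mulrBl.
rewrite sumrB (bigD1 s) //= eqxx mul1r big1 ?addr0; last first.
  by move=> t /negPf->; rewrite mul0r.
have BB := mulmxKpV (submx_refl B).
have := congr1 (fun M : 'M_(_, _) =>
  M (enum_rank s) (enum_rank ((rho, rho') : W))) BB.
rewrite mxE (reindex (@enum_rank 'S_n)) /=; last first.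
  by apply: onW_bij; apply: enum_rank_bij.
under eq_bigr => t _ do rewrite -cE BE /=.
by move=> ->; rewrite BE subrr.
Qed.

Section SlotwiseStraightening.
Variables (K : comPzRingType) (T X : finType) (A : lmodType K) (I : A -> Prop).
Hypotheses (I0 : I 0) (ID : forall x y, I x -> I y -> I (x + y)).
Hypothesis IZ : forall c x, I x -> I (c *: x).
Variables (p : T -> X -> X -> K) (Psi : {ffun T -> X} -> A).

Definition set_slot (tau : {ffun T -> X}) i x : {ffun T -> X} :=
  [ffun j => if j == i then x else tau j].

Hypothesis straighten_slot : forall tau i,
  I (Psi tau - \sum_x p i (tau i) x *: Psi (set_slot tau i x)).

(** Induction on a list [s] of slots: [c s] carries the coefficients once the slots of [s] are
    straightened, the other slots being still equal to those of [tau]. *)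
Lemma straighten_all tau :
  I (Psi tau - \sum_(tau' : {ffun T -> X})
                 (\prod_i p i (tau i) (tau' i)) *: Psi tau').
Proof.
have Isum (J : finType) (F : J -> A) : (forall j, I (F j)) -> I (\sum_j F j).
  by move=> IF; apply: big_ind.
pose c (s : seq T) (tau tau' : {ffun T -> X}) : K :=
  \prod_i if i \in s then p i (tau i) (tau' i) else (tau' i == tau i)%:R.
suff H s : uniq s -> forall tau, I (Psi tau - \sum_tau' c s tau tau' *: Psi tau').
  have := H _ (enum_uniq T) tau; rewrite /c.
  under eq_bigr => t _ do under eq_bigr => i _ do rewrite mem_enum.
  by [].
elim: s => [_ {}tau|i s IHs /= /andP[i_s us] {}tau].
  rewrite (bigD1 tau) //= big1 ?addr0 => [|t tt].
    by rewrite /c big1 ?scale1r ?subrr // => i _; rewrite eqxx.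
  suff -> : c [::] tau t = 0 by rewrite scale0r.
  have [i ti] : exists i, t i != tau i.
    apply/existsP; rewrite -negb_forall; apply: contraNN tt.
    by move=> /forallP st; apply/eqP/ffunP => m; rewrite (eqP (st m)).
  by rewrite /c (bigD1 i) //= (negPf ti) mul0r.
have -> : \sum_tau' c (i :: s) tau tau' *: Psi tau' =
    \sum_x p i (tau i) x *:
      \sum_tau' c s (set_slot tau i x) tau' *: Psi tau'.
  under [RHS]eq_bigr => x _ do rewrite scaler_sumr.
  rewrite exchange_big /=; apply: eq_bigr => t _.
  under [RHS]eq_bigr => x _ do rewrite scalerA.
  rewrite -scaler_suml; congr (_ *: _).
  have cE x : c s (set_slot tau i x) t = (t i == x)%:R *
     \prod_(j | j != i) if j \in s then p j (tau j) (t j) else (t j == tau j)%:R.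
    rewrite /c (bigD1 i) //= (negPf i_s) ffunE eqxx; congr (_ * _).
    by apply: eq_bigr => j /negPf ji; rewrite ffunE ji.
  under eq_bigr => x _ do rewrite cE.
  rewrite (bigD1 (t i)) //= eqxx [X in _ + X]big1 ?addr0 => [|x /negPf xt]; last first.
    by rewrite eq_sym xt mul0r mulr0.
  rewrite mul1r /c (bigD1 i) //= mem_head; congr (_ * _).
  by apply: eq_bigr => j /negPf ji; rewrite in_cons ji.
rewrite -[X in I X](subrKA (\sum_x p i (tau i) x *: Psi (set_slot tau i x))).
apply: ID => //; rewrite -sumrB; apply: Isum => x; rewrite -scalerBr.
by apply: IZ; apply: IHs.
Qed.

End SlotwiseStraightening.

(** * Ideals and minors *)

Section IdealClosure.
Variable A : comNzRingType.
Implicit Types (S : set A) (a x y : A).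

Lemma mem_ideal_gen S x : S x -> ideal_gen S x.
Proof.
move=> Sx; exists 1%N, (fun=> 1), (fun=> x); split=> //.
by rewrite big_ord1 mul1r.
Qed.

Lemma ideal_gen0 S : ideal_gen S 0.
Proof.
exists 0%N, (fun=> 0), (fun=> 0); split; first by case.
by rewrite big_ord0.
Qed.

Lemma ideal_genD S x y : ideal_gen S x -> ideal_gen S y -> ideal_gen S (x + y).
Proof.
move=> [n [a [g [Sg ->]]]] [n' [a' [g' [Sg' ->]]]].
pose glue (B : Type) (u : 'I_n -> B) (u' : 'I_n' -> B) (i : 'I_(n + n')) :=
  match fintype.split i with inl j => u j | inr j => u' j end.
exists (n + n')%N, (glue A a a'), (glue A g g'); split.
  by move=> k; rewrite /glue; case: (fintype.split k).
rewrite big_split_ord /=; congr (_ + _); apply: eq_bigr => i _; rewrite /glue.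
  by rewrite (unsplitK (inl i)).
by rewrite (unsplitK (inr i)).
Qed.

Lemma ideal_genM S a x : ideal_gen S x -> ideal_gen S (a * x).
Proof.
move=> [n [b [g [Sg ->]]]]; exists n, (fun k => a * b k), g; split=> //.
by rewrite mulr_sumr; apply: eq_bigr => k _; rewrite mulrA.
Qed.

Lemma ideal_gen_sub S (J : A -> Prop) :
  J 0 -> (forall x y, J x -> J y -> J (x + y)) -> (forall a x, J x -> J (a * x)) ->
  (forall x, S x -> J x) -> forall x, ideal_gen S x -> J x.
Proof.
move=> J0 JD JM SJ x [n [a [g [Sg ->]]]].
by apply: big_ind => // k _; apply/JM/SJ.
Qed.

Variables (I : finType) (P : pred I) (J : I -> set A).
Hypotheses (J0 : forall i, J i 0)
  (JD : forall i x y, J i x -> J i y -> J i (x + y))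
  (JM : forall i a x, J i x -> J i (a * x)).

Lemma ideal_sum0 : ideal_sum P J 0.
Proof. by exists (fun=> 0); rewrite big1. Qed.

Lemma ideal_sumD x y : ideal_sum P J x -> ideal_sum P J y -> ideal_sum P J (x + y).
Proof.
move=> [q [Jq ->]] [q' [Jq' ->]]; exists (fun i => q i + q' i).
by split=> [i Pi|]; [apply: JD; [apply: Jq | apply: Jq'] | rewrite big_split].
Qed.

Lemma ideal_sumM a x : ideal_sum P J x -> ideal_sum P J (a * x).
Proof.
move=> [q [Jq ->]]; exists (fun i => a * q i).
by split=> [i Pi|]; [apply/JM/Jq | rewrite mulr_sumr].
Qed.

Lemma mem_ideal_sum i x : P i -> J i x -> ideal_sum P J x.
Proof.
move=> Pi Jx; exists (fun j => if j == i then x else 0); split=> [j _|].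
  by case: eqP => [->|_].
by rewrite (bigD1 i) //= eqxx big1 ?addr0 // => j /andP[_ /negPf->].
Qed.

End IdealClosure.

(** Used because [minors] admits only increasing selections. Ranking the values of [f] gives a
    permutation whose inverse sorts them. *)
Lemma sort_injection (m s : nat) (f : 'I_s -> 'I_m) : injective f ->
  exists p : 'S_s, {homo f \o p : a b / (a < b)%N}.
Proof.
move=> f_inj; pose rk a := #|[pred b | (f b < f a)%N]|.
have rk_lt a : (rk a < s)%N.
  rewrite -[X in (_ < X)%N]card_ord; apply: proper_card; apply/properP; split.
    by apply/fintype.subsetP.
  by exists a; rewrite // inE ltnn.
have rk_mono a b : (f a < f b)%N -> (rk a < rk b)%N.
  move=> lt; apply: proper_card; apply/properP; split.
    by apply/fintype.subsetP => c; rewrite !inE => /ltn_trans; apply.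
  by exists a; rewrite !inE // ltnn.
have rk_inj : injective (fun a => Ordinal (rk_lt a)).
  move=> a b /(congr1 val) /= E; apply/f_inj/val_inj.
  by case: (ltngtP (f a) (f b)) => // /rk_mono; rewrite E ltnn.
exists (perm rk_inj)^-1%g => a b lt /=.
have rkE c : rk ((perm rk_inj)^-1%g c) = c.
  by rewrite -[RHS](congr1 val (permKV (perm rk_inj) c)) permE.
case: (ltngtP (f ((perm rk_inj)^-1%g a)) (f ((perm rk_inj)^-1%g b))) => //.
  by move=> /rk_mono; rewrite !rkE => /(ltn_trans lt); rewrite ltnn.
by move=> /val_inj/f_inj/perm_inj E; rewrite E ltnn in lt.
Qed.

Section Minors.
Variables (A : comNzRingType) (m n s : nat) (M : 'M[A]_(m, n)).

(** A repeated row or column gives 0; otherwise sorting both selections changes the determinant only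
    by a sign. *)
Lemma det_mxsub_minors (f : 'I_s -> 'I_m) (g : 'I_s -> 'I_n) :
  ideal_gen (minors s M) (\det (mxsub f g M)).
Proof.
have [/injectiveP f_inj|/injectivePn[a [b ab fab]]] :=
    boolP (injectiveb f); last first.
  rewrite (determinant_alternate ab) => [|c]; first exact: ideal_gen0.
  by rewrite !mxE fab.
have [/injectiveP g_inj|/injectivePn[a [b ab gab]]] :=
    boolP (injectiveb g); last first.
  rewrite -det_tr (determinant_alternate ab) => [|c]; first exact: ideal_gen0.
  by rewrite !mxE gab.
have [p fp] := sort_injection f_inj; have [q gq] := sort_injection g_inj.
have -> : mxsub f g M = perm_mx p^-1 *m mxsub (f \o p) (g \o q) M *m perm_mx q.
  rewrite -row_permE -{2}[q]invgK -col_permE.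
  by apply/matrixP => a b; rewrite !mxE /= !(permKV, invgK).
rewrite !det_mulmx mulrAC; apply/ideal_genM/mem_ideal_gen.
by exists (f \o p), (g \o q).
Qed.

(** The factors at positions outside the image of [e] do not depend on [x] and come out; the rest is
    a Leibniz expansion. *)
Lemma antisym_prod_minor N (u : 'I_N -> 'I_m) (c : 'I_N -> 'I_n)
    (e : 'I_s -> 'I_N) (e_inj : injective e) (t : 'S_N) :
  \sum_(x : 'S_s) (-1) ^+ x * \prod_k M (u k) (c ((perm_ext e_inj x * t)%g k))
  = (\prod_(k | k \notin codom e) M (u k) (c (t k)))
    * \det (mxsub (u \o e) (c \o t \o e) M).
Proof.
rewrite /determinant mulr_sumr; apply: eq_bigr => x _.
rewrite mulrCA; congr (_ * _); rewrite (bigID (fun k => k \in codom e)) /= mulrC.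
congr (_ * _).
  apply: eq_bigr => k /negP ke; rewrite permM perm_ext_out // => a.
  by apply/eqP => E; apply: ke; rewrite -E; exact: codom_f.
rewrite -big_uniq /=; last by rewrite map_inj_uniq ?enum_uniq.
rewrite big_image /=; apply: eq_bigr => a _.
by rewrite !mxE /= permM perm_ext_in.
Qed.

End Minors.

(** * The ideal of the tensor train variety *)

Lemma poly_fun0 (K : numFieldType) (p : {poly K}) : (forall t, p.[t] = 0) -> p = 0.
Proof.
move=> p0; apply/eqP; apply: contraT => pN0.
pose rs : seq K := [seq i%:R | i <- iota 0 (size p)].
have := @max_poly_roots _ p rs pN0; rewrite size_map size_iota ltnn; apply.
  by apply/allP => t _; rewrite /root p0.
by rewrite map_inj_uniq ?iota_uniq // => i j /eqP; rewrite eqr_nat => /eqP.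
Qed.

Section Evaluation.
Variables (K : fieldType) (T : finType).
Implicit Types (f g : coord_ring K T) (x : coord_space K T).

Lemma eval_at0 x : eval_at 0 x = 0.
Proof. exact: meval0. Qed.

Lemma eval_at1 x : eval_at 1 x = 1.
Proof. exact: meval1. Qed.

Lemma eval_atD f g x : eval_at (f + g) x = eval_at f x + eval_at g x.
Proof. exact: mevalD. Qed.

Lemma eval_atM f g x : eval_at (f * g) x = eval_at f x * eval_at g x.
Proof. exact: mevalM. Qed.

Lemma eval_atZ c f x : eval_at (c *: f) x = c * eval_at f x.
Proof. exact: mevalZ. Qed.

Lemma eval_at_sum (I : Type) (s : seq I) (P : pred I) (F : I -> coord_ring K T) x :
  eval_at (\sum_(i <- s | P i) F i) x = \sum_(i <- s | P i) eval_at (F i) x.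
Proof. exact: raddf_sum. Qed.

Lemma eval_at_prod (I : Type) (s : seq I) (P : pred I) (F : I -> coord_ring K T) x :
  eval_at (\prod_(i <- s | P i) F i) x = \prod_(i <- s | P i) eval_at (F i) x.
Proof. exact: rmorph_prod. Qed.

Lemma eval_atXU t x : eval_at 'X_(enum_rank t) x = x t.
Proof. by rewrite /eval_at mevalXU enum_rankK. Qed.

Lemma eval_at_homog k f c x : f \is k.-homog ->
  eval_at f (c *: x) = c ^+ k * eval_at f x.
Proof.
move=> /dhomogP hf; rewrite /eval_at !mevalE mulr_sumr !big_seq.
apply: eq_bigr => m /hf <-; rewrite mulrCA; congr (_ * _).
under eq_bigr => i _ do rewrite ffunE exprMn.
by rewrite big_split /= prodrXr -mdegE.
Qed.

Lemma homog_partition f :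
  f = \sum_(k < mmeasure mdeg f) pihomog mdeg k f.
Proof. exact: pihomog_partitionE. Qed.

End Evaluation.

Section TensorTrainIdeal.
Variables (K : numFieldType) (N : nat) (d : 'I_N -> nat) (r : 'I_N.+1 -> nat).
Hypotheses (N_gt0 : (0 < N)%N) (r_gt0 : forall i, (0 < r i)%N).
Implicit Types (A B : tt_cores K d r) (f g : coord_ring K (tensor_idx d)).

Definition tt_ideal : set (coord_ring K (tensor_idx d)) :=
  [set f | forall A, eval_at f (tt_contract A) = 0].

Lemma tt_contractZ c A : exists A', tt_contract A' = c *: tt_contract A.
Proof.
pose k0 := Ordinal N_gt0.
exists (fun k j => (if k == k0 then c else 1) *: A k j).
apply/ffunP => j; rewrite !ffunE scaler_sumr; apply: eq_bigr => al _.
under eq_bigr => k _ do rewrite mxE.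
rewrite big_split /= (bigD1 k0) //= big1 ?mulr1 // => k /negPf->.
by [].
Qed.

(** With all core entries equal to 1, each tensor entry counts the bond indices and is nonzero in
    characteristic 0. *)
Lemma tt_contract_neq0 : (forall k, 0 < d k)%N -> exists A, tt_contract A != 0.
Proof.
move=> d_gt0; exists (fun _ _ => const_mx 1).
apply/eqP => /ffunP /(_ [ffun k => Ordinal (d_gt0 k)]) /eqP.
rewrite !ffunE; under eq_bigr do under eq_bigr do rewrite mxE.
under eq_bigr do rewrite big1 //.
rewrite sumr_const pnatr_eq0; apply/negP; rewrite -lt0n; apply/card_gt0P.
by exists [ffun i => Ordinal (r_gt0 i)].
Qed.

(** For fixed cores, the values of the components of [f] are the coefficients of a polynomial in the
    scaling factor that vanishes everywhere. *)
Lemma tt_ideal_homog : homogeneous_ideal tt_ideal.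
Proof.
move=> f ttf k A.
set n := mmeasure mdeg f.
pose p : {poly K} := \poly_(l < n) eval_at (pihomog mdeg l f) (tt_contract A).
have : p = 0.
  apply: poly_fun0 => c; have [A' eA'] := tt_contractZ c A.
  rewrite -(ttf A') eA' [in RHS](homog_partition f) eval_at_sum horner_poly.
  apply: eq_bigr => l _; rewrite (eval_at_homog (k := l)) ?pihomogP //.
  by rewrite mulrC.
have [lt_kn|le_nk] := ltnP k n.
  by move=> /(congr1 (fun q : {poly K} => q`_k)); rewrite coef_poly lt_kn coef0.
move=> _; suff -> : pihomog mdeg k f = 0 by rewrite eval_at0.
rewrite [f]homog_partition raddf_sum big1 //= => l _.
rewrite (@pihomog_ne0 _ _ mdeg l) ?pihomogP //.
by rewrite neq_ltn (leq_trans (ltn_ord l)).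
Qed.

Definition core_line A B t : tt_cores K d r :=
  fun k j => A k j + t *: (B k j - A k j).

Definition tt_line A B (j : tensor_idx d) : {poly K} :=
  \sum_(al : {dffun forall i : 'I_N.+1, 'I_(r i)})
     \prod_(k < N)
        ((A k (j k) (al (right_bond k)) (al (left_bond k)))%:P
         + 'X * (B k (j k) (al (right_bond k)) (al (left_bond k))
                 - A k (j k) (al (right_bond k)) (al (left_bond k)))%:P).

Definition eval_line f A B : {poly K} :=
  mmap polyC (fun k => tt_line A B (enum_val k)) f.

Lemma eval_lineE f A B t :
  (eval_line f A B).[t]
    = eval_at f (tt_contract (core_line A B t)).
Proof.
rewrite /eval_at mevalE /eval_line /mmap horner_sum; apply: eq_bigr => m _.
rewrite hornerM hornerC /mmap1 horner_prod; congr (_ * _).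
apply: eq_bigr => i _; rewrite horner_exp /tt_line horner_sum ffunE.
congr (_ ^+ _); apply: eq_bigr => al _; rewrite horner_prod.
by apply: eq_bigr => k _; rewrite !hornerE !mxE.
Qed.

(** If [u] is nonzero at [A0] and [v] at [A1], their restrictions to the line are nonzero at 0 and
    at 1, yet their product is the zero polynomial. *)
Lemma tt_ideal_prime : prime_ideal tt_ideal.
Proof.
have A : tt_cores K d r by move=> k j; exact: 0.
split; first split.
- by rewrite inE /= => B; rewrite eval_at0.
- apply/negP; rewrite inE /= => /(_ A)/eqP.
  by rewrite eval_at1 oner_eq0.
- move=> a u v; rewrite !inE /= => tu tv B.
  by rewrite eval_atD eval_atM tu tv mulr0 addr0.
move=> u v; rewrite !inE /= => tuv.
have [tu|/existsNP[A0 /eqP uA0]] := pselect (tt_ideal u).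
  by apply/orP; left; rewrite inE.
have [tv|/existsNP[A1 /eqP vA1]] := pselect (tt_ideal v).
  by apply/orP; right; rewrite inE.
have : eval_line u A0 A1 * eval_line v A0 A1 == 0.
  apply/eqP/poly_fun0 => t; rewrite hornerM !eval_lineE -eval_atM.
  exact: tuv.
rewrite mulf_eq0 => /orP[]/eqP z; exfalso.
  case/eqP: uA0; rewrite -(horner0 0) -z eval_lineE; congr (eval_at _ (tt_contract _)).
  by apply/functional_extensionality_dep => k; rewrite /core_line;
    apply/funext => j; rewrite scale0r addr0.
case/eqP: vA1; rewrite -(horner0 1) -z eval_lineE; congr (eval_at _ (tt_contract _)).
by apply/functional_extensionality_dep => k; rewrite /core_line; apply/funext => j;
  rewrite scale1r addrC subrK.
Qed.

(** For a form the closure adds no condition, its zero locus being closed already; other polynomials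
    are split into homogeneous components. *)
Lemma vanishing_ideal_tt : (forall k, 0 < d k)%N ->
  vanishing_ideal (tt_variety r) = tt_ideal.
Proof.
move=> d_gt0.
have vanP f : homogeneous f ->
    (forall L, tt_variety r L -> vanishes_at f L) <-> tt_ideal f.
  move=> hf; have [k fk] := hf; split=> [vf A|tf L].
    have vA B : tt_contract B != 0 -> eval_at f (tt_contract B) = 0.
      move=> nz.
      have dB : \dim <[tt_contract B]>%VS == 1%N by rewrite dim_vline nz.
      pose L : proj_space K (tensor_idx d) :=
        exist (fun L : {vspace coord_space K (tensor_idx d)} => \dim L == 1%N) _ dB.
      apply: (vf L _ _ (memv_line _)).
      by move=> Z [_ ZB]; apply: ZB; exists B.
    (* The zero tensor is no projective point; writing it as 0 times a nonzero contraction also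
       covers forms of degree 0. *)
    have [A0|/vA//] := eqVneq (tt_contract A) 0.
    have [B Bn0] := tt_contract_neq0 d_gt0.
    by rewrite A0 -(scale0r (tt_contract B)) (eval_at_homog _ _ fk) vA ?mulr0.
  move=> ttL; suff : zero_locus [set f] L by apply.
  apply: ttL; split; first by exists [set f] => // _ ->.
  move=> L' [A [_ LA]] _ -> x; rewrite LA => /vlineP[c ->].
  by rewrite (eval_at_homog _ _ fk) tf mulr0.
apply/seteqP; split=> f.
  apply: ideal_gen_sub => [A|x y tx ty A|a x tx A|x [hx vx]].
  - exact: eval_at0.
  - by rewrite eval_atD tx ty addr0.
  - by rewrite eval_atM tx mulr0.
  - exact/vanP.
move=> tf; rewrite [f]homog_partition; apply: big_ind.
- exact: ideal_gen0.
- exact: ideal_genD.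
- move=> k _; apply: mem_ideal_gen.
  have hk : homogeneous (pihomog mdeg k f) by exists k; exact: pihomogP.
  by split=> //; apply/(vanP _ hk)/tt_ideal_homog.
Qed.

End TensorTrainIdeal.

(** * Vanishing of the minors *)

Definition bond_idx N (r : 'I_N.+1 -> nat) := {dffun forall i : 'I_N.+1, 'I_(r i)}.

(* Swapping the parts beyond [i] is an involution on the pairs of bond indices
   with value [b] at [i]; the cardinal on the right spares us from splitting a
   bond index into its two halves. *)
Lemma cut_sum (K : numFieldType) (N : nat) (r : 'I_N.+1 -> nat) (i : 'I_N.+1)
    (b : 'I_(r i)) (X Y : bond_idx r -> K) :
  (forall al al' : bond_idx r,
     (forall l : 'I_N.+1, (l <= i)%N -> al l = al' l) -> X al = X al') ->
  (forall al al' : bond_idx r,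
     (forall l : 'I_N.+1, (i <= l)%N -> al l = al' l) -> Y al = Y al') ->
  (\sum_(al : bond_idx r | al i == b) X al)
    * (\sum_(al : bond_idx r | al i == b) Y al)
    = #|[pred al : bond_idx r | al i == b]|%:R
      * \sum_(al : bond_idx r | al i == b) X al * Y al.
Proof.
move=> Xle Yge.
pose mix (al al' : bond_idx r) :
    bond_idx r :=
  [ffun l : 'I_N.+1 => if (l <= i)%N then al l else al' l].
pose swap (p : _ * _) := (mix p.1 p.2, mix p.2 p.1).
have swapK : involutive swap.
  move=> [al al']; rewrite /swap /=; congr (_, _); apply/ffunP => l;
  by rewrite !ffunE; case: (l <= i)%N.
rewrite big_distrlr pair_big /= (reindex_inj (inv_inj swapK)) /=.
transitivity (\sum_(p : bond_idx r * bond_idx r | (p.1 i == b) && (p.2 i == b))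
    X p.1 * Y p.1).
  apply: eq_big => [[al al']|[al al']] /=; rewrite !ffunE leqnn //.
  move=> /andP[/eqP ali /eqP al'i]; congr (_ * _).
    by apply: Xle => l li; rewrite ffunE li.
  apply: Yge => l il; rewrite ffunE; case: ifP => // li.
  have -> : l = i by apply/val_inj/anti_leq; rewrite li il.
  by rewrite ali.
rewrite -(pair_big (fun al : bond_idx r => al i == b)
  (fun al' : bond_idx r => al' i == b)
  (fun al _ => X al * Y al)) /= mulr_sumr; apply: eq_bigr => al _.
by rewrite sumr_const mulr_natl.
Qed.

Section FlatteningRank.
Variables (K : numFieldType) (N : nat) (d : 'I_N -> nat) (r : 'I_N.+1 -> nat).
Hypothesis r_gt0 : forall i, (0 < r i)%N.

Lemma merge_idx_lt i (u : row_idx d i) v v' (k : 'I_N) : (k < i)%N ->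
  merge_idx u v k = merge_idx u v' k.
Proof.
move=> ki; rewrite !ffunE; case: ltnP => // ik.
by have := leq_trans ki ik; rewrite ltnn.
Qed.

Lemma merge_idx_ge i (u u' : row_idx d i) v (k : 'I_N) : (i <= k)%N ->
  merge_idx u v k = merge_idx u' v k.
Proof.
move=> ik; rewrite !ffunE; case: ltnP => // ki.
by have := leq_trans ki ik; rewrite ltnn.
Qed.

(** The selected submatrix factors through the [r i] values of the bond [i], so its rank is smaller
    than its size. *)
Lemma minor_tt_ideal (i : 'I_N.+1) p :
  minors (r i).+1 (flattening K d i) p -> tt_ideal (K := K) r p.
Proof.
move=> [f [g [_ _ ->]]] A; rewrite /eval_at -det_map_mx.
set x := tt_contract A; set M := map_mx _ _.
pose u a := enum_val (f a); pose v a := enum_val (g a).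
(* [v ord0] and [u ord0] are fillers: [X] reads only the factors before [i], and [Y] only the
   others. *)
pose jl a := merge_idx (u a) (v ord0); pose jr b := merge_idx (u ord0) (v b).
pose core (j : tensor_idx d) (al : bond_idx r) k :=
  A k (j k) (al (right_bond k)) (al (left_bond k)).
pose X a (al : bond_idx r) := \prod_(k < N | (k < i)%N) core (jl a) al k.
pose Y b (al : bond_idx r) := \prod_(k < N | ~~ (k < i)%N) core (jr b) al k.
pose C (c : 'I_(r i)) : K :=
  #|[pred al : bond_idx r | al i == c]|%:R.
have C_neq0 c : C c != 0.
  rewrite pnatr_eq0 -lt0n; apply/card_gt0P.
  exists [ffun l : 'I_N.+1 => insubd (Ordinal (r_gt0 l)) (c : nat)].
  by rewrite inE /= ffunE; apply/eqP/val_inj; rewrite val_insubd ltn_ord.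
(* Dividing by [C c] offsets the multiplicity in [cut_sum]. *)
pose L := \matrix_(a < (r i).+1, c < r i)
  ((C c)^-1 * \sum_(al : bond_idx r | al i == c) X a al).
pose Q := \matrix_(c < r i, b < (r i).+1)
  (\sum_(al : bond_idx r | al i == c) Y b al).
have ML : M = L *m Q.
  apply/matrixP => a b; rewrite !mxE /= mevalXU enum_rankK ffunE.
  rewrite (partition_big (fun al : bond_idx r => al i)
    predT) //=; apply: eq_bigr => c _; rewrite !mxE -mulrA cut_sum.
  - rewrite mulKf //; apply: eq_bigr => al _.
    rewrite (bigID (fun k : 'I_N => (k < i)%N)) /=; congr (_ * _).
      by apply: eq_bigr => k ki; rewrite /core (merge_idx_lt _ _ (v ord0)).
    apply: eq_bigr => k; rewrite -leqNgt => ik.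
    by rewrite /core (merge_idx_ge _ (u ord0)).
  - move=> al al' E; apply: eq_bigr => k ki.
    by rewrite /core !E //= ltnW.
  - move=> al al' E; apply: eq_bigr => k; rewrite -leqNgt => ik.
    by rewrite /core !E //= ltnW.
apply/eqP; apply: contraT => detN0.
have := mxrank_unit (etrans (unitmxE M) (etrans (unitfE _) detN0)).
rewrite ML => rk; have := leq_trans (mxrankM_maxl L Q) (rank_leq_col L).
by rewrite rk ltnn.
Qed.

End FlatteningRank.

(** * Polynomials as sums over words *)

Lemma prod_natb (K : comPzSemiRingType) (I : finType) (b : I -> bool) :
  \prod_i (b i)%:R = [forall i, b i]%:R :> K.
Proof.
have [/forallP bT|/forallPn[i /negPf bi]] := boolP [forall i, b i].
  by rewrite big1 // => i _; rewrite bT.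
by rewrite (bigD1 i) //= bi mul0r.
Qed.

(* Ryser's formula for the permanent: the signed sum over [S] keeps only the
   surjective maps. *)
Lemma ryser_formula (K : comPzRingType) (n : nat) (a : 'I_n -> 'I_n -> K) :
  \sum_(S : {ffun 'I_n -> bool})
     (\prod_x (-1) ^+ (~~ S x)) * (\prod_m \sum_m' (S m')%:R * a m m')
  = \sum_(s : 'S_n) \prod_m a m (s m).
Proof.
under eq_bigr => S _ do rewrite bigA_distr_bigA mulr_sumr.
rewrite exchange_big /=.
(* The signed sum over [S] splits over the letters [x]. An empty product is 1, so the factor at [x]
   is 0 if [g] misses [x] and 1 otherwise. *)
pose onto (g : {ffun 'I_n -> 'I_n}) : K :=
  \prod_x (1 - \prod_(m | g m == x) 0).
have ontoE g : onto g = (injectiveb g)%:R.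
  rewrite /onto; have [/injectiveP g_inj|ninj] := boolP (injectiveb g).
    rewrite big1 // => x _; have /codomP[m ->] : x \in codom g.
      exact: injF_onto.
    by rewrite (bigD1 m) //= mul0r subr0.
  have [x xg] : exists x, x \notin codom g.
    apply/existsP; rewrite -negb_forall; apply: contraNN ninj => /forallP gT.
    suff /image_injP inj : #|codom g| == #|'I_n|.
      by apply/injectiveP => x y; apply: inj.
    by apply/eqP/eq_card => x; rewrite gT.
  rewrite (bigD1 x) //= big_pred0 ?subrr ?mul0r // => m; apply/negbTE.
  by apply: contraNN xg => /eqP<-; exact: codom_f.
transitivity (\sum_(g : {ffun 'I_n -> 'I_n}) onto g * \prod_m a m (g m)).
  apply: eq_bigr => g _.
  transitivity (\sum_(S : {ffun 'I_n -> bool})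
      (\prod_x (-1) ^+ (~~ S x) * \prod_m (S (g m))%:R) * \prod_m a m (g m)).
    by apply: eq_bigr => S _; rewrite -mulrA; congr (_ * _); exact: big_split.
  rewrite -mulr_suml; congr (_ * _).
  transitivity (\sum_(S : {ffun 'I_n -> bool})
      \prod_x ((-1) ^+ (~~ S x) * \prod_(m | g m == x) (S x)%:R) : K).
    apply: eq_bigr => S _; rewrite big_split /=; congr (_ * _).
    rewrite (partition_big g predT) //=; apply: eq_bigr => x _.
    by apply: eq_bigr => m /eqP->.
  rewrite -(bigA_distr_bigA (fun x (b : bool) => (-1) ^+ (~~ b)
    * \prod_(m | g m == x) b%:R)) /=.
  apply: eq_bigr => x _; rewrite big_bool /= expr0 mul1r expr1 mulN1r.
  by rewrite big1.
under eq_bigr => g _ do rewrite ontoE.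
rewrite (bigID (fun g : {ffun 'I_n -> 'I_n} => injectiveb g)) /= addrC.
rewrite big1 ?add0r => [|g /negPf->]; last by rewrite mul0r.
rewrite (reindex (fun s : 'S_n => pval s)) /=; last first.
  exists (insubd (1%g : 'S_n)) => [s _|g gi]; first exact: valKd.
  exact: insubdK.
apply: eq_big => [s|s _]; first exact: (valP s).
by rewrite (valP s) mul1r; apply: eq_bigr => m _; rewrite pvalE.
Qed.

Section Words.
Variables (K : numFieldType) (N n : nat) (d : 'I_N -> nat).

(** Ordering the variables of a monomial lets permutations of the positions act on each tensor
    factor separately. *)
Definition word := {ffun 'I_n -> tensor_idx d}.

Definition word_monom (w : word) : coord_ring K (tensor_idx d) :=
  \prod_m 'X_(enum_rank (w m)).

Definition permute_word (sg : {ffun 'I_N -> 'S_n}) (w : word) : word :=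
  [ffun m : 'I_n => [ffun k : 'I_N => w (sg k m) k] : tensor_idx d].

Lemma permute_word_bij sg : bijective (permute_word sg).
Proof.
exists (permute_word [ffun k => (sg k)^-1%g]) => w; apply/ffunP => m;
by apply/ffunP => k; rewrite !ffunE ?permKV ?permK.
Qed.

Lemma homog_word_sum (f : coord_ring K (tensor_idx d)) : f \is n.-homog ->
  exists F : word -> K, f = \sum_w F w *: word_monom w.
Proof.
move=> /dhomogP hf; rewrite [f]mpolyE big_seq.
apply: (big_ind (fun g => exists F : word -> K,
  g = \sum_w F w *: word_monom w)).
- by exists (fun=> 0); rewrite big1 // => w _; rewrite scale0r.
- move=> x y [F ->] [G ->]; exists (fun w => F w + G w).
  by rewrite -big_split; apply: eq_bigr => w _; rewrite scalerDl.
move=> m /hf; change (mdeg m = n -> exists F : word -> K,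
  f@_m *: 'X_[m] = \sum_w F w *: word_monom w) => mn.
pose s := flatten [seq nseq (m i) i | i <- enum 'I_(#|tensor_idx d|)].
have sz : size s == n.
  rewrite size_flatten sumnE big_map big_map -mn mdegE big_enum /=.
  by apply/eqP/eq_bigr => i _; rewrite size_nseq.
pose w0 : word := [ffun a => enum_val (tnth (Tuple sz) a)].
have w0E : word_monom w0 = 'X_[m].
  rewrite /word_monom; under eq_bigr => a _ do rewrite ffunE enum_valK.
  rewrite -(big_tuple _ _ (Tuple sz) predT (fun i => 'X_i)) /=.
  rewrite big_flatten big_map big_enum /= mpolyXE_id; apply: eq_bigr => i _.
  by rewrite big_nseq -Monoid.iteropE.
exists (fun w => if w == w0 then f@_m else 0).
rewrite (bigD1 w0) //= eqxx w0E big1 ?addr0 // => w /negPf->.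
by rewrite scale0r.
Qed.

End Words.

(** * Orthogonality relations from vanishing on contracted tensors *)

Section Orthogonality.
Variables (K : numFieldType) (N n R : nat) (d : 'I_N -> nat) (r : 'I_N.+1 -> nat).
Hypotheses (r_gt0 : forall i, (0 < r i)%N).
Hypotheses (r_first : r ord0 = 1%N) (r_last : r ord_max = 1%N).
Implicit Types (sg : {ffun 'I_N -> 'S_n}) (rho : {ffun 'I_N -> {ffun 'I_n -> 'I_R}}).

Definition perm_at sg (l : nat) : 'S_n := oapp sg 1%g (insub l).

Lemma perm_at_ord sg (k : 'I_N) : perm_at sg k = sg k.
Proof. by rewrite /perm_at valK. Qed.

(* Slot [i] is the bond on the left of factor [i]; for [i = 0] this is the
   trivial bond, and the missing permutation is taken to be 1. *)
Definition prev_perm sg (i : 'I_N) : 'S_n :=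
  if nat_of_ord i is l.+1 then perm_at sg l else 1%g.

Definition slot_perm sg : {ffun 'I_N -> 'S_n} :=
  [ffun i => ((prev_perm sg i)^-1 * sg i)%g].

(** The right bond of factor [k] is the left bond of factor [k + 1], hence slot [k + 1]. After the
    last factor, the default 0 is the only letter of the trivial bond. *)
Definition right_letter rho (k : 'I_N) (m : 'I_n) : nat :=
  oapp (fun k' : 'I_N => nat_of_ord (rho k' m)) 0%N (insub k.+1).

Definition bond_match rho rho' (al : bond_idx r) (k : 'I_N) m : bool :=
  (al (right_bond k) == right_letter rho k m :> nat)
  && (al (left_bond k) == rho' k m :> nat).

(** The left bonds, with the trivial last bond, determine [al], so one term survives. The right
    bonds then require [rho i] at the position given by the previous permutation to equal [rho' i]
    at the one given by [sg i]: the word match of slot [i]. *)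
Lemma bond_match_sum rho rho' sg :
  (forall i m, (rho i m < r (left_bond i))%N) ->
  (forall i m, (rho' i m < r (left_bond i))%N) ->
  \sum_(al : {ffun 'I_n -> bond_idx r})
     \prod_k \prod_m (bond_match rho rho' (al m) k (sg k m))%:R
  = \prod_i (word_match (r (left_bond i)) (rho i) (rho' i) (slot_perm sg i))%:R
  :> K.
Proof.
move=> sm sm'.
pose val_at m (l : nat) : nat :=
  oapp (fun k : 'I_N => nat_of_ord (rho' k (sg k m))) 0%N (insub l).
have val_at_lt m (l : 'I_N.+1) : (val_at m l < r l)%N.
  rewrite /val_at; case: insubP => [k _ kl|_] //=.
  by have -> : l = left_bond k by apply: val_inj.
pose al0 : {ffun 'I_n -> bond_idx r} :=
  [ffun m : 'I_n => [ffun l : 'I_N.+1 => Ordinal (val_at_lt m l)] : bond_idx r].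
have al0E m l : al0 m l = val_at m l :> nat by rewrite !ffunE.
have val_at_left m (k : 'I_N) : val_at m (left_bond k) = rho' k (sg k m).
  by rewrite /val_at /= valK.
rewrite (bigD1 al0) //= [X in _ + X]big1 ?addr0 => [|al al_neq]; last first.
  have [m [k neq]] : exists m (k : 'I_N),
      al m (left_bond k) != rho' k (sg k m) :> nat.
    apply: contrapT => H; case/eqP: al_neq; apply/ffunP => m; apply/ffunP => l.
    have same (k : 'I_N) : al m (left_bond k) = rho' k (sg k m) :> nat.
      by apply/eqP; apply: contrapT => /negP nk; apply: H; exists m, k.
    apply: val_inj; rewrite /= al0E; have [lN|Nl] := ltnP l N.
      have -> : l = left_bond (Ordinal lN) by apply: val_inj.
      by rewrite same val_at_left.
    have lmax : l = ord_max.
      by apply/val_inj/anti_leq; rewrite /= -ltnS ltn_ord.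
    have lt1 (x : 'I_(r l)) : nat_of_ord x = 0%N.
      have rl : (r l <= 1)%N by rewrite lmax r_last.
      by apply/eqP; rewrite -leqn0 -ltnS; apply: leq_trans (ltn_ord x) rl.
    by rewrite lt1 -al0E lt1.
  by rewrite (bigD1 k) //= (bigD1 m) //= /bond_match (negPf neq) andbF !mul0r.
under eq_bigr => k _ do rewrite prod_natb.
rewrite !prod_natb; congr (nat_of_bool _)%:R; apply/forallP/forallP.
- move=> bm i; apply/andP; split; first by apply/forallP => m; exact: sm'.
  apply/forallP => m0; apply/eqP/val_inj; rewrite ffunE permM /=.
  set m := ((prev_perm sg i)^-1)%g m0.
  have -> : m0 = prev_perm sg i m by rewrite permKV.
  case Ei : (nat_of_ord i) => [|l].
    (* The alphabet of the first slot has one letter, so its words always match. *)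
    have lb0 : left_bond i = ord0 by apply: val_inj.
    have := sm i (prev_perm sg i m); have := sm' i (sg i m).
    by rewrite lb0 r_first !ltnS !leqn0 => /eqP-> /eqP->.
  have lN : (l < N)%N by have := ltn_ord i; rewrite Ei => /ltnW.
  have /forallP/(_ m)/andP[/eqP + _] := bm (Ordinal lN).
  rewrite al0E /prev_perm Ei /= /right_letter /= /val_at /=.
  have -> : bump 0 l = i by rewrite Ei.
  rewrite -Ei valK /= => ->.
  by rewrite -[l in LHS]/(nat_of_ord (Ordinal lN)) perm_at_ord.
- move=> wm k; apply/forallP => m; apply/andP; split; last first.
    by rewrite al0E val_at_left.
  rewrite al0E /val_at /right_letter.
  have -> : nat_of_ord (right_bond k) = k.+1 by [].
  case: insubP => [i _ ik|_] //=.
  have /andP[_ /forallP/(_ (prev_perm sg i m))] := wm i.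
  rewrite ffunE permM permK => /eqP <-.
  by rewrite /prev_perm /= ik perm_at_ord.
Qed.

(* Evaluate at cores that are sums of elementary ones, one for each selected
   letter of [w], and combine the evaluations by Ryser's formula into the part
   that is multilinear in these elementary cores. *)
Lemma tt_word_orthogonal (F : word n d -> K) (w : word n d) rho rho' :
  tt_ideal (K := K) r (\sum_w' F w' *: word_monom K w') ->
  \sum_sg F (permute_word sg w)
    * \prod_i (word_match (r (left_bond i)) (rho i) (rho' i) (slot_perm sg i))%:R
  = 0.
Proof.
move=> ttf.
(* A letter outside the alphabet of its slot makes the match fail for every [sg]. *)
have [/forallP sm|/forallPn[i smi]] :=
    boolP [forall i, [forall m, (rho' i m < r (left_bond i))%N
                            && (rho i m < r (left_bond i))%N]]; last first.
  rewrite big1 // => sg _; rewrite (bigD1 i) //=.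
  have [/andP[/forallP sm /forallP mt]|] := boolP (word_match _ _ _ _);
    last by rewrite mul0r mulr0.
  case/negP: smi; apply/forallP => m; rewrite sm /=.
  by rewrite (eqP (mt m)) sm.
pose a (w' : word n d) (al : {ffun 'I_n -> bond_idx r}) k m m' : K :=
  ((w m' k == w' m k) && bond_match rho rho' (al m) k m')%:R.
pose sgn (S : {ffun 'I_N -> {ffun 'I_n -> bool}}) : K :=
  \prod_k \prod_x (-1) ^+ (~~ S k x).
have vanish (S : {ffun 'I_N -> {ffun 'I_n -> bool}}) :
    \sum_w' F w' * \sum_al \prod_k \prod_m \sum_m' (S k m')%:R * a w' al k m m' = 0.
  pose A : tt_cores K d r := fun k j => \matrix_(x, y)
    \sum_m' (S k m')%:R * ((w m' k == j) &&
      ((x == right_letter rho k m' :> nat) && (y == rho' k m' :> nat)))%:R.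
  rewrite -[RHS](ttf A) eval_at_sum; apply: eq_bigr => w' _.
  rewrite eval_atZ eval_at_prod; congr (_ * _).
  under [RHS]eq_bigr => m _ do rewrite eval_atXU ffunE.
  rewrite bigA_distr_bigA; apply: eq_bigr => al _; rewrite exchange_big /=.
  by apply: eq_bigr => m _; apply: eq_bigr => k _; rewrite mxE.
have : \sum_S sgn S * \sum_w' F w'
    * \sum_al \prod_k \prod_m \sum_m' (S k m')%:R * a w' al k m m' = 0.
  by rewrite big1 // => S _; rewrite vanish mulr0.
under eq_bigr => S _ do rewrite mulr_sumr.
rewrite exchange_big /= => sum0; rewrite -[RHS]sum0.
transitivity (\sum_w' F w' * \sum_al
  \sum_(sg : {ffun 'I_N -> 'S_n}) \prod_k \prod_m a w' al k m (sg k m)).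
  under [RHS]eq_bigr => w' _ do rewrite exchange_big mulr_sumr /=.
  rewrite exchange_big /=; apply: eq_bigr => sg _.
  rewrite (bigD1 (permute_word sg w)) //= [X in _ + X]big1 ?addr0; last first.
    move=> w' w'_neq; rewrite big1 ?mulr0 // => al _.
    have [m [k neq]] : exists m k, w (sg k m) k != w' m k.
      apply: contrapT => H; case/eqP: w'_neq; apply/ffunP => m; apply/ffunP => k.
      rewrite !ffunE; apply/eqP; apply: contrapT => /negP nk.
      by apply: H; exists m, k; rewrite eq_sym.
    by rewrite (bigD1 k) //= (bigD1 m) //= /a (negPf neq) !mul0r.
  congr (_ * _).
  rewrite -bond_match_sum => [|i m|i m]; last 2 first.
  - by have /forallP/(_ m)/andP[] := sm i.
  - by have /forallP/(_ m)/andP[] := sm i.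
  apply: eq_bigr => al _; apply: eq_bigr => k _; apply: eq_bigr => m _.
  by rewrite /a !ffunE eqxx.
apply: eq_bigr => w' _.
under [RHS]eq_bigr => S _ do rewrite mulrCA mulr_sumr.
rewrite -mulr_sumr [in RHS]exchange_big /=; congr (_ * _); apply: eq_bigr => al _.
rewrite -(bigA_distr_bigA (fun k (s : 'S_n) => \prod_m a w' al k m (s m))) /=.
under eq_bigr => k _ do rewrite -ryser_formula.
rewrite [LHS]bigA_distr_bigA; apply: eq_bigr => S _.
by rewrite big_split.
Qed.

End Orthogonality.

(** * Generation by minors *)

Section Assembly.
Variables (K : numFieldType) (N n : nat) (d : 'I_N -> nat) (r : 'I_N.+1 -> nat).
Hypotheses (r_gt0 : forall i, (0 < r i)%N).
Hypotheses (r_first : r ord0 = 1%N) (r_last : r ord_max = 1%N).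
Implicit Types (sg tau : {ffun 'I_N -> 'S_n}).

Definition minor_ideal : set (coord_ring K (tensor_idx d)) :=
  ideal_sum (fun i : 'I_N.+1 => 0 < i < N)%N
    (fun i => ideal_gen (minors (r i).+1 (flattening K d i))).

Lemma minor_ideal0 : minor_ideal 0.
Proof. by apply: ideal_sum0 => i; exact: ideal_gen0. Qed.

Lemma minor_idealD x y : minor_ideal x -> minor_ideal y -> minor_ideal (x + y).
Proof. by apply: ideal_sumD => i; exact: ideal_genD. Qed.

Lemma minor_idealM a x : minor_ideal x -> minor_ideal (a * x).
Proof. by apply: ideal_sumM => i; exact: ideal_genM. Qed.

Lemma minor_idealZ c x : minor_ideal x -> minor_ideal (c *: x).
Proof. by rewrite -mul_mpolyC; apply: minor_idealM. Qed.

(** This flattening has a single row, indexed by the empty function. *)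
Lemma minors_flattening0 s p : (1 < s)%N -> ~ minors s (flattening K d 0) p.
Proof.
move=> s1 [f [g [fh _ _]]].
have := fh (Ordinal (ltnW s1)) (Ordinal s1) isT.
suff -> : f (Ordinal (ltnW s1)) = f (Ordinal s1) by rewrite ltnn.
apply: enum_val_inj; apply/ffunP => -[k k0]; by [].
Qed.

(** Slot 0 contributes no minors, which allows all [N] slots to be treated alike. *)
Lemma minors_flattening_ideal (i : 'I_N) p :
  ideal_gen (minors (r (left_bond i)).+1 (flattening K d i)) p -> minor_ideal p.
Proof.
have [i0|i_gt0] := posnP i; last first.
  move=> Ip; apply: (@mem_ideal_sum _ _ _ _ _ (left_bond i)) => //.
    by move=> j; exact: ideal_gen0.
  by rewrite /= i_gt0 ltn_ord.
apply: ideal_gen_sub; [exact: minor_ideal0 | exact: minor_idealD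
  | exact: minor_idealM | ].
by move=> x; rewrite i0 => /minors_flattening0; case; rewrite ltnS.
Qed.

Definition cumul_perm tau (k : nat) : 'S_n :=
  (\prod_(0 <= l < k.+1) perm_at tau l)%g.

Lemma cumul_slot_perm sg (k : 'I_N) : cumul_perm (slot_perm sg) k = sg k.
Proof.
suff H l : (l < N)%N -> cumul_perm (slot_perm sg) l = perm_at sg l.
  by rewrite H // perm_at_ord.
elim: l => [|l IHl] lN.
  rewrite /cumul_perm big_nat1 -[0%N]/(nat_of_ord (Ordinal lN)) !perm_at_ord.
  by rewrite ffunE invg1 mul1g.
rewrite /cumul_perm big_nat_recr //=.
rewrite -/(cumul_perm (slot_perm sg) l) (IHl (ltnW lN)).
rewrite -[l.+1]/(nat_of_ord (Ordinal lN)) !perm_at_ord ffunE /prev_perm /=.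
by rewrite mulKVg.
Qed.

Section SlotRelation.
Variables (w : word n d).

(** Parametrized by relative permutations: changing slot [i] affects the factors from [i] on
    together and leaves the earlier ones fixed. *)
Definition slot_monom tau : coord_ring K (tensor_idx d) :=
  word_monom K (permute_word [ffun k : 'I_N => cumul_perm tau k] w).

Lemma perm_at_set_slot tau (i : 'I_N) t l :
  perm_at (set_slot tau i t) l = if l == i :> nat then t else perm_at tau l.
Proof.
rewrite /perm_at; case: insubP => [k _ kl|lN] /=.
  by rewrite ffunE -kl -val_eqE.
by case: eqP => // li; rewrite li ltn_ord in lN.
Qed.

(** The factors before [i] ignore [t], and each factor from [i] on is permuted by [head * t * tail].
    Relabelling the positions by the inverse of [head] leaves [t] acting on the columns alone. *)
Lemma slot_monom_flattening tau (i : 'I_N) :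
  exists (u : 'I_n -> 'I_#|{: row_idx d i}|) (c : 'I_n -> 'I_#|{: col_idx d i}|),
  forall t, slot_monom (set_slot tau i t)
            = \prod_m flattening K d i (u m) (c (t m)).
Proof.
pose head := (\prod_(0 <= l < i) perm_at tau l)%g.
pose tail (k : nat) := (\prod_(i.+1 <= l < k.+1) perm_at tau l)%g.
pose u m : row_idx d i :=
  [ffun k : {k : 'I_N | (k < i)%N} =>
     w (cumul_perm tau (val k) ((head^-1)%g m)) (val k)].
pose c m : col_idx d i :=
  [ffun k : {k : 'I_N | (i <= k)%N} => w (tail (val k) m) (val k)].
exists (fun m => enum_rank (u m)), (fun m => enum_rank (c m)) => t.
rewrite /slot_monom /word_monom (reindex_inj (@perm_inj _ head^-1%g)) /=.
apply: eq_bigr => m _; rewrite mxE !enum_rankK; congr ('X_(enum_rank _)).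
apply/ffunP => k; rewrite !ffunE; case: ltnP => [ki|ik]; rewrite ffunE /=.
  suff -> : cumul_perm (set_slot tau i t) k = cumul_perm tau k by [].
  rewrite /cumul_perm; apply: eq_big_nat => l /andP[_ lk].
  rewrite perm_at_set_slot; case: eqP => // li.
  by have := leq_trans lk ki; rewrite li ltnn.
have -> : cumul_perm (set_slot tau i t) k = (head * (t * tail k))%g.
  rewrite /cumul_perm (@big_cat_nat _ _ _ i) //=; last exact: leqW.
  congr (_ * _)%g.
    apply: eq_big_nat => l /andP[_ li]; rewrite perm_at_set_slot.
    by case: eqP => // E; rewrite E ltnn in li.
  rewrite big_ltn ?ltnS // perm_at_set_slot eqxx; congr (_ * _)%g.
  apply: eq_big_nat => l /andP[il _]; rewrite perm_at_set_slot.
  by case: eqP => // E; rewrite E ltnn in il.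
by rewrite !permM permKV.
Qed.

Lemma slot_monom_alternating tau (i : 'I_N)
    (e : 'I_(r (left_bond i)).+1 -> 'I_n) (e_inj : injective e) t :
  minor_ideal (\sum_(x : 'S_(r (left_bond i)).+1)
    (-1) ^+ x *: slot_monom (set_slot tau i (perm_ext e_inj x * t)%g)).
Proof.
have [u [c uc]] := slot_monom_flattening tau i.
under eq_bigr => x _ do rewrite uc scaler_sign -mulr_sign.
rewrite antisym_prod_minor; apply/minor_idealM/minors_flattening_ideal.
exact: det_mxsub_minors.
Qed.

End SlotRelation.

Lemma homog_tt_ideal_minor (f : coord_ring K (tensor_idx d)) :
  f \is n.-homog -> tt_ideal r f -> minor_ideal f.
Proof.
move=> /homog_word_sum[F fE] ttf.
pose R := \max_i r i; pose W := ({ffun 'I_n -> 'I_R} * {ffun 'I_n -> 'I_R})%type.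
have [q qP] := choice (fun i : 'I_N => straightening_coefficients K n
  (r_gt0 (left_bond i)) (leq_bigmax (left_bond i) : (_ <= R)%N)).
pose p i (s t : 'S_n) : K :=
  \sum_(x : W) (word_match (r (left_bond i)) x.1 x.2 s)%:R * q i t x.
have straight w tau : minor_ideal (slot_monom w tau -
    \sum_(tau' : {ffun 'I_N -> 'S_n})
      (\prod_i p i (tau i) (tau' i)) *: slot_monom w tau').
  apply: straighten_all; [exact: minor_ideal0 | exact: minor_idealD
    | exact: minor_idealZ | ].
  move=> {}tau i.
  have := qP i _ _ (fun t => slot_monom w (set_slot tau i t)) minor_ideal0
    minor_idealD minor_idealZ (fun e e_inj t => slot_monom_alternating w tau e_inj t)
    (tau i).
  suff -> : set_slot tau i (tau i) = tau by [].
  by apply/ffunP => j; rewrite ffunE; case: eqP => [->|].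
have word_part w : minor_ideal
    (\sum_(sg : {ffun 'I_N -> 'S_n}) F (permute_word sg w)
      *: word_monom K (permute_word sg w)).
  have monomE sg : word_monom K (permute_word sg w) = slot_monom w (slot_perm sg).
    rewrite /slot_monom; congr (word_monom K (permute_word _ w)).
    by apply/ffunP => k; rewrite ffunE cumul_slot_perm.
  pose D sg := slot_monom w (slot_perm sg) -
    \sum_(tau' : {ffun 'I_N -> 'S_n})
      (\prod_i p i (slot_perm sg i) (tau' i)) *: slot_monom w tau'.
  (* Replacing the monomials by [D] is free: the straightened terms cancel in the sum over [sg]. *)
  suff -> : \sum_sg F (permute_word sg w)
      *: word_monom K (permute_word sg w)
      = \sum_sg F (permute_word sg w) *: D sg.
    apply: big_ind; [exact: minor_ideal0 | exact: minor_idealD | ].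
    by move=> sg _; apply/minor_idealZ/straight.
  under [RHS]eq_bigr => sg _ do rewrite scalerBr -monomE.
  rewrite sumrB [X in _ - X](_ : _ = 0) ?subr0 //.
  under eq_bigr => sg _ do rewrite scaler_sumr.
  rewrite exchange_big big1 //= => tau' _.
  under eq_bigr => sg _ do rewrite scalerA.
  rewrite -scaler_suml; set cf := \sum_sg _; suff -> : cf = 0 by rewrite scale0r.
  (* Expanding the product picks a pair of words [x i] for each slot; the part depending on [sg] is
     then the sum in the orthogonality relation. *)
  rewrite /cf; under eq_bigr => sg _ do rewrite bigA_distr_bigA mulr_sumr.
  rewrite exchange_big big1 //= => x _.
  under eq_bigr => sg _ do rewrite big_split mulrA /=.
  rewrite -mulr_suml.
  have := @tt_word_orthogonal K N n R d r r_gt0 r_first r_last F w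
    [ffun i => (x i).1] [ffun i => (x i).2]; rewrite -fE => /(_ ttf) orth.
  rewrite [X in X * _](_ : _ = 0) ?mul0r // -[RHS]orth.
  apply: eq_bigr => sg _; congr (_ * _); apply: eq_bigr => i _.
  by rewrite !ffunE.
(* Each tuple permutes the words bijectively, so the sum over all tuples gives [f] exactly [c]
   times, and [c] is invertible in characteristic 0. *)
pose c : K := #|{ffun 'I_N -> 'S_n}|%:R.
have c_neq0 : c != 0.
  by rewrite pnatr_eq0 -lt0n; apply/card_gt0P; exists [ffun=> 1%g].
rewrite -(scalerK c_neq0 f); apply: minor_idealZ.
have -> : c *: f = \sum_(w : word n d)
    \sum_(sg : {ffun 'I_N -> 'S_n}) F (permute_word sg w)
      *: word_monom K (permute_word sg w).
  rewrite exchange_big /= scaler_nat -sumr_const; apply: eq_bigr => sg _.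
  by rewrite fE (reindex (permute_word sg)) //; exact/onW_bij/permute_word_bij.
by apply: big_ind; [exact: minor_ideal0 | exact: minor_idealD | ].
Qed.

End Assembly.

Lemma tt_ideal_minor_ideal (K : numFieldType) (N : nat) (d : 'I_N -> nat)
    (r : 'I_N.+1 -> nat) : (0 < N)%N -> (forall i, 0 < r i)%N ->
  r ord0 = 1%N -> r ord_max = 1%N ->
  tt_ideal (K := K) (d := d) r = minor_ideal (K := K) r.
Proof.
move=> N_gt0 r_gt0 r_first r_last; apply/seteqP; split=> f.
  move=> ttf; rewrite [f]homog_partition.
  apply: big_ind; [exact: minor_ideal0 | exact: minor_idealD | move=> k _].
  apply: (homog_tt_ideal_minor r_gt0 r_first r_last (pihomogP _ _ _)).
  exact: tt_ideal_homog.
move=> [q [Jq ->]] A; rewrite eval_at_sum big1 // => i Pi.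
apply: (ideal_gen_sub (J := tt_ideal (K := K) r) _ _ _ _ (Jq i Pi)).
- by move=> B; exact: eval_at0.
- by move=> x y tx ty B; rewrite eval_atD tx ty addr0.
- by move=> a x tx B; rewrite eval_atM tx mulr0.
- by move=> x; exact: minor_tt_ideal.
Qed.

Theorem corollary5p4 (R : realType) (N : nat) (N_gt0 : (0 < N)%N)
    (d : 'I_N -> nat) (r : 'I_N.+1 -> nat)
    (d_gt0 : forall k, (0 < d k)%N) (r_gt0 : forall i, (0 < r i)%N)
    (r_first : r ord0 = 1%N) (r_last : r ord_max = 1%N) :
  let I_TT := vanishing_ideal (tt_variety (K := R[i]) (d := d) r) in
  [/\ homogeneous_ideal I_TT,
      prime_ideal I_TT
    & I_TT = ideal_sum (fun i : 'I_N.+1 => 0 < i < N)%N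
               (fun i => ideal_gen (minors (r i).+1 (flattening R[i] d i)))].
Proof.
move=> I_TT.
have I_TTE : I_TT = tt_ideal (K := R[i]) r by exact: vanishing_ideal_tt.
rewrite I_TTE; split.
- exact: tt_ideal_homog.
- exact: tt_ideal_prime.
- exact: tt_ideal_minor_ideal.
Qed.
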